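(* Let $n\ge 3$. An element $w\in\tilde A_{n-1}$ is CFC if and only if one (equivalently, any) of its reduced expressions $\mathbf{w}$ satisfies one of the following conditions: (a) each generator occurs at most once in $\mathbf{w}$; (b) $\mathbf{w}$ is an alternating word and $|\mathbf{w}_{s_0}|=|\mathbf{w}_{s_1}|=\cdots=|\mathbf{w}_{s_{n-1}}|\ge 2$.
   Context: $\tilde A_{n-1}$ is the affine Coxeter group with generators $s_0,s_1,\dots,s_{n-1}$ whose Coxeter diagram is the $n$-cycle $s_0-s_1-\cdots-s_{n-1}-s_0$ (all edges with $m=3$; non-adjacent generators commute). Put $s_n=s_0$. For a Coxeter group, an element is fully commutative (FC) if any two of its reduced expressions are related by a sequence of transpositions of adjacent commuting generators. A cyclic shift of a word $s_{i_1}\cdots s_{i_k}$ is any word $s_{i_j}\cdots s_{i_k}s_{i_1}\cdots s_{i_{j-1}}$. An element is cyclically fully commutative (CFC) if every cyclic shift of every one of its reduced expressions is a reduced expression of an FC element. $|\mathbf{w}_s|$ is the number of occurrences of the generator $s$ in $\mathbf{w}$. A reduced word in the generators of $\tilde A_{n-1}$ is alternating if, for every $i=0,1,\dots,n-1$, the occurrences of $s_i$ alternate with those of $s_{i+1}$ (i.e. in the sequence obtained by keeping only the letters $s_i,s_{i+1}$, no two consecutive letters are equal). *)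

(* Defs.v *)
From HB Require Import structures.
From Stdlib Require Import Relation_Operators.
From mathcomp Require Import all_boot boolp.

Set Implicit Arguments.
Unset Strict Implicit.
Unset Printing Implicit Defensive.

Local Open Scope group_scope.
Local Open Scope quotient_scope.

(* The value 0 encodes m(s,t) = oo. *)
Record coxeter_matrix (T : choiceType) := CoxeterMatrix {
  cox_m :> T -> T -> nat;
  cox_m_sym : forall s t, cox_m s t = cox_m t s;
  cox_m_diag : forall s t, (cox_m s t == 1%N) = (s == t) }.

(* The congruence on words generated by (st)^m(s,t) = 1; it contains ss = 1
   (the case s = t), so that the quotient monoid is the group with the same
   presentation. For m(s,t) = 0 the relation is trivial. *)
Inductive cox_cong (T : choiceType) (M : coxeter_matrix T) :
    seq T -> seq T -> Prop :=
| cox_cong_rel s t : cox_cong M (flatten (nseq (M s t) [:: s; t])) [::]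
| cox_cong_cat u u' v v' :
    cox_cong M u u' -> cox_cong M v v' -> cox_cong M (u ++ v) (u' ++ v')
| cox_cong_refl u : cox_cong M u u
| cox_cong_sym u v : cox_cong M u v -> cox_cong M v u
| cox_cong_trans u v w : cox_cong M u v -> cox_cong M v w -> cox_cong M u w.

Section CoxeterGroup.
Variables (T : choiceType) (M : coxeter_matrix T).

Definition cox_congb : rel (seq T) := fun u v => `[< cox_cong M u v >].

Fact cox_congb_equiv : equiv_class_of cox_congb.
Proof.
split.
- by move=> u; apply/asboolP; apply: cox_cong_refl.
- by move=> u v; apply/asboolP/asboolP; apply: cox_cong_sym.
- by move=> v u w /asboolP uv /asboolP vw; apply/asboolP;
    apply: cox_cong_trans uv vw.
Qed.

Canonical cox_equiv := EquivRelPack cox_congb_equiv.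

Definition coxeter_group : Type := {eq_quot cox_equiv}.
HB.instance Definition _ := Choice.on coxeter_group.
HB.instance Definition _ := EqQuotient.on coxeter_group.

Lemma cox_piP (u v : seq T) :
  \pi_coxeter_group u = \pi_coxeter_group v <-> cox_cong M u v.
Proof.
by split=> [/eqP|uv]; [rewrite eqmodE => /asboolP | apply/eqP; rewrite eqmodE;
  apply/asboolP].
Qed.

Lemma cox_cong_repr u : cox_cong M (repr (\pi_coxeter_group u)) u.
Proof. by apply/cox_piP; rewrite reprK. Qed.

Lemma cox_cong_rev u v : cox_cong M u v -> cox_cong M (rev u) (rev v).
Proof.
elim=> {u v} [s t|u u' v v' _ uu' _ vv'|u|u v _|u v w _ uv _].
- have -> : rev (flatten (nseq (M s t) [:: s; t])) =
            flatten (nseq (M t s) [:: t; s]).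
    rewrite cox_m_sym rev_flatten map_nseq; congr flatten.
    by elim: (M t s) => //= k IHk; rewrite rev_cons IHk -cats1
      -(nseqD k 1) addn1.
  exact: cox_cong_rel.
- by rewrite !rev_cat; apply: cox_cong_cat.
- exact: cox_cong_refl.
- exact: cox_cong_sym.
- exact: cox_cong_trans.
Qed.

Lemma cox_cong_revl u : cox_cong M (rev u ++ u) [::].
Proof.
elim: u => [|s u IHu]; first exact: cox_cong_refl.
rewrite rev_cons cat_rcons -[s :: _]/([::] ++ [:: s; s] ++ u).
have ss : cox_cong M [:: s; s] [::].
  have := cox_cong_rel M s s.
  by have /eqP -> : M s s == 1%N by rewrite cox_m_diag.
apply: cox_cong_trans IHu; apply: cox_cong_cat (cox_cong_refl _ _) _.
exact: (cox_cong_cat ss (cox_cong_refl _ u)).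
Qed.

Lemma cox_pi_surj (x : coxeter_group) : exists u, x = \pi_coxeter_group u.
Proof. by exists (repr x); rewrite reprK. Qed.

Definition cox_one : coxeter_group := \pi_coxeter_group [::].
Definition cox_mul (x y : coxeter_group) : coxeter_group :=
  \pi_coxeter_group (repr x ++ repr y).
Definition cox_inv (x : coxeter_group) : coxeter_group :=
  \pi_coxeter_group (rev (repr x)).

Lemma cox_mul_pi u v :
  cox_mul (\pi_coxeter_group u) (\pi_coxeter_group v) =
  \pi_coxeter_group (u ++ v).
Proof. by apply/cox_piP; apply: cox_cong_cat; apply: cox_cong_repr. Qed.

Lemma cox_inv_pi u :
  cox_inv (\pi_coxeter_group u) = \pi_coxeter_group (rev u).
Proof. by apply/cox_piP/cox_cong_rev/cox_cong_repr. Qed.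

Fact cox_mulA : associative cox_mul.
Proof.
move=> x y z; have [u ->] := cox_pi_surj x.
have [v ->] := cox_pi_surj y; have [t ->] := cox_pi_surj z.
by rewrite !cox_mul_pi catA.
Qed.

Fact cox_mul1 : left_id cox_one cox_mul.
Proof. by move=> x; have [u ->] := cox_pi_surj x; rewrite cox_mul_pi. Qed.

Fact cox_mulr1 : right_id cox_one cox_mul.
Proof. by move=> x; have [u ->] := cox_pi_surj x; rewrite cox_mul_pi cats0. Qed.

Fact cox_mulV : left_inverse cox_one cox_inv cox_mul.
Proof.
move=> x; have [u ->] := cox_pi_surj x; rewrite cox_inv_pi cox_mul_pi.
exact/cox_piP/cox_cong_revl.
Qed.

Fact cox_mulrV : right_inverse cox_one cox_inv cox_mul.
Proof.
move=> x; have [u ->] := cox_pi_surj x; rewrite cox_inv_pi cox_mul_pi -{1}[u]revK.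
exact/cox_piP/cox_cong_revl.
Qed.

HB.instance Definition _ := isGroup.Build coxeter_group
  cox_mulA cox_mul1 cox_mulr1 cox_mulV cox_mulrV.

Definition cox_gen (s : T) : coxeter_group := \pi_coxeter_group [:: s].

Definition word_prod (u : seq T) : coxeter_group := \prod_(s <- u) cox_gen s.

Lemma word_prodE u : word_prod u = \pi_coxeter_group u.
Proof.
rewrite /word_prod; elim: u => [|s u IHu]; first by rewrite big_nil.
by rewrite big_cons IHu [LHS]cox_mul_pi.
Qed.

Lemma word_prodP u v : word_prod u = word_prod v <-> cox_cong M u v.
Proof. by rewrite !word_prodE; apply: cox_piP. Qed.

Definition reduced_expression (w : coxeter_group) (u : seq T) : Prop :=
  word_prod u = w /\ forall v, word_prod v = w -> size u <= size v.

Definition commutation_step (u v : seq T) : Prop :=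
  exists (a b : seq T) (s t : T),
    [/\ commute (cox_gen s) (cox_gen t),
        u = a ++ [:: s, t & b] & v = a ++ [:: t, s & b]].

Definition fully_commutative (w : coxeter_group) : Prop :=
  forall u v, reduced_expression w u -> reduced_expression w v ->
    clos_refl_trans _ commutation_step u v.

Definition cyclically_fully_commutative (w : coxeter_group) : Prop :=
  forall u, reduced_expression w u -> forall k,
    exists2 x, fully_commutative x & reduced_expression x (rot k u).

End CoxeterGroup.

Section AffineA.
Variable n : nat.

(* The n-cycle; this is the diagram of type affine A_(n-1) only for n >= 3. *)
Definition affineA_m (i j : 'I_n) : nat :=
  (if i == j then 1 else if (j == ordS i) || (i == ordS j) then 3 else 2)%N.

Fact affineA_m_sym i j : affineA_m i j = affineA_m j i.
Proof. by rewrite /affineA_m eq_sym orbC. Qed.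

Fact affineA_m_diag i j : (affineA_m i j == 1%N) = (i == j).
Proof. by rewrite /affineA_m; case: (i == j) => //; case: ifP. Qed.

Definition affineA_matrix := CoxeterMatrix affineA_m_sym affineA_m_diag.

Definition affineA : groupType := coxeter_group affineA_matrix.

Definition alternating (u : seq 'I_n) : Prop :=
  forall i : 'I_n,
    sorted (fun x y => x != y) [seq x <- u | (x == i) || (x == ordS i)].

End AffineA.

(* Main.v *)
From Stdlib Require Import Relation_Operators.
Require Import Defs.
From mathcomp Require Import all_boot boolp perm zify.

(** The bridge between both sides of the equivalence is that, for n >= 3, a word
    is a reduced word of a fully commutative element exactly when it alternates.

    Alternating words are reduced and fully commutative.  A commutation never
    exchanges the adjacent generators s_i and s_(i+1), so it preserves all the
    two-letter subwords that define alternation.  An alternating word contains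
    no factor s s, and no factor s t s with t adjacent to s either, since the
    other neighbour of s would be missing between the two letters s.  In a
    simply laced Coxeter group, a word whose commutation class avoids these two
    kinds of factors is reduced and its class contains every reduced word of
    the same element ([short_braid_avoiding_size] and
    [short_braid_avoiding_swaps_eq]).  This rests on the reflections crossed by
    a word: the set of those crossed an odd number of times depends only on the
    group element ([crosses_word_prod]), so a word crossing distinct reflections
    is reduced, and a left descent of the element is a crossed generator.  In
    an avoiding word a crossed generator t can be moved to the front by
    commutations ([short_braid_avoiding_front]): an obstacle s adjacent to t
    would, by the geometry of the dihedral group of s and t
    ([dihedral_crosses]), bring a factor s t s to the front.

    Reduced words of fully commutative elements alternate ([fc_consecutive]).
    If a neighbour p of s is absent between two consecutive letters s, consider
    the other neighbour q of s.  With no q between them the word is not reduced;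
    with one q it can be rewritten by a braid relation, which changes the
    multiplicity of s; with more, two consecutive letters q enclose a shorter
    interval without s, and the argument repeats.

    Hence an element is cyclically fully commutative if and only if all the
    rotations of its reduced words alternate, which is a question about two
    letters a, b at a time.  An alternating word in a and b stays alternating
    when closed up into a cycle exactly when a and b are equally frequent
    ([alternates_cycle]), and otherwise some rotation fails to alternate unless
    the word has at most one letter.  Going around the diagram, the
    multiplicities are either all at most 1 or all equal. *)

Set Implicit Arguments.
Unset Strict Implicit.
Unset Printing Implicit Defensive.

Local Open Scope group_scope.

(** * Words and the reflections they cross *)

Section Reflections.
Variables (T : choiceType) (M : coxeter_matrix T).
Implicit Types (s t : T) (u v x y : seq T) (r : coxeter_group M).

Local Notation gen := (cox_gen M).
Local Notation wp := (word_prod M).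

Lemma word_prod_nil : wp [::] = 1.
Proof. exact: big_nil. Qed.

Lemma word_prod_cons s u : wp (s :: u) = gen s * wp u.
Proof. exact: big_cons. Qed.

Lemma word_prod_cat u v : wp (u ++ v) = wp u * wp v.
Proof. exact: big_cat. Qed.

Definition word_prodS :=
  (word_prod_cat, word_prod_cons, word_prod_nil).

Lemma word_prod_nseq k s t :
  wp (flatten (nseq k [:: s; t])) = (gen s * gen t) ^+ k.
Proof.
elim: k => [|k IHk]; first exact: word_prod_nil.
by rewrite /= !word_prod_cons IHk mulgA expgS.
Qed.

Lemma gen_relation s t : (gen s * gen t) ^+ M s t = 1.
Proof. by rewrite -word_prod_nseq -word_prod_nil; apply/word_prodP/cox_cong_rel. Qed.

Lemma gen_involution s : gen s * gen s = 1.
Proof. by have := gen_relation s s; have /eqP -> : M s s == 1%N by rewrite cox_m_diag. Qed.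

Lemma gen_inv s : (gen s)^-1 = gen s.
Proof. by apply: (mulgI (gen s)); rewrite mulgV gen_involution. Qed.

Lemma genK s : involutive (mul (gen s)).
Proof. by move=> r; rewrite mulgA gen_involution mul1g. Qed.

Lemma gen_conjK s : involutive (conjg^~ (gen s)).
Proof. by move=> r; rewrite -conjgM gen_involution conjg1. Qed.

Lemma gen_conjE s r : r ^ gen s = gen s * r * gen s.
Proof. by rewrite conjgE gen_inv mulgA. Qed.

Lemma word_prod_rev u : wp (rev u) = (wp u)^-1.
Proof.
elim: u => [|s u IHu]; first by rewrite word_prod_nil invg1.
by rewrite rev_cons -cats1 !word_prodS mulg1 IHu invgM gen_inv.
Qed.

Lemma gen_commute s t : M s t = 2 -> commute (gen s) (gen t).
Proof.
move=> Mst; have := gen_relation s t; rewrite Mst expg2 => st1.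
rewrite /commute; apply: (mulIg (gen s * gen t)).
by rewrite st1 -mulgA genK gen_involution.
Qed.

Lemma gen_braid s t : M s t = 3 ->
  gen s * gen t * gen s = gen t * gen s * gen t.
Proof.
move=> Mst; have := gen_relation s t; rewrite Mst expgS expg2 => st1.
apply: (mulIg (gen t * gen s * gen t)).
by rewrite -!mulgA !(genK, gen_involution) in st1 *.
Qed.

(** The entries are the reflections s_1 .. s_i .. s_1 for u = s_1 .. s_k, that
    is, the walls met in succession by the gallery of u from the base
    chamber. *)
Fixpoint refls u : seq (coxeter_group M) :=
  if u is s :: v then gen s :: [seq r ^ gen s | r <- refls v] else [::].

(** In geometric terms, the wall of r separates the base chamber from its image
    under the element of u. *)
Definition crosses u r : bool := odd (count_mem r (refls u)).

Lemma size_refls u : size (refls u) = size u.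
Proof. by elim: u => //= s u IHu; rewrite size_map IHu. Qed.

Lemma refls_cat u v :
  refls (u ++ v) = refls u ++ [seq r ^ (wp u)^-1 | r <- refls v].
Proof.
elim: u => [|s u IHu] /=.
  by rewrite word_prod_nil invg1 (eq_map (@conjg1 _)) map_id.
rewrite IHu map_cat -map_comp word_prod_cons; congr (_ :: _ ++ _).
by apply: eq_map => r /=; rewrite -conjgM invgM gen_inv.
Qed.

Lemma crosses_cat u v r : crosses (u ++ v) r = crosses u r (+) crosses v (r ^ wp u).
Proof.
rewrite /crosses refls_cat count_cat oddD count_map; congr (_ (+) odd _).
by apply: eq_count => q /=; rewrite (can2_eq (conjgKV _) (conjgK _)).
Qed.

Lemma crosses_cons s u r :
  crosses (s :: u) r = (r == gen s) (+) crosses u (r ^ gen s).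
Proof.
rewrite -cat1s crosses_cat !word_prodS mulg1; congr (_ (+) _).
by rewrite /crosses /= addn0 oddb eq_sym.
Qed.

(** In this form the sequence of reflections is visibly periodic, its period
    being the order of s t. *)
Lemma refls_nseq k s t :
  refls (flatten (nseq k [:: s; t])) =
  [seq (gen s * gen t) ^+ i * gen s | i <- iota 0 k.*2].
Proof.
elim: k => [|k IHk] //=; rewrite IHk (iotaDl 2 0) -!map_comp expg0 mul1g expg1.
rewrite gen_conjE; congr [:: _, _ & _]; apply: eq_map => i /=.
by rewrite !gen_conjE [_ ^+ (2 + i)]expgS expgSr !mulgA.
Qed.

(** A defining relation of order m walks once around a dihedral configuration
    and meets each of its m walls twice, so it does not change any parity. *)
Lemma crosses_cong u v r : cox_cong M u v -> crosses u r = crosses v r.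
Proof.
move=> uv; elim: uv r => {u v} [s t|u u' v v' uu' IHu _ IHv|//|u v _ IH|u v w _ IHu _ IHv] r.
- rewrite /crosses refls_nseq -addnn iotaD map_cat count_cat add0n.
  rewrite -{2}[M s t]addn0 iotaDl -map_comp.
  rewrite (eq_map (g := fun i => (gen s * gen t) ^+ i * gen s)) ?addnn ?odd_double //.
  by move=> i /=; rewrite expgnDr gen_relation mul1g.
- by rewrite !crosses_cat IHu IHv (proj2 (word_prodP M u u') uu').
- by rewrite IH.
- by rewrite IHu IHv.
Qed.

Lemma crosses_word_prod u v r : wp u = wp v -> crosses u r = crosses v r.
Proof. by move/word_prodP/crosses_cong. Qed.

Lemma crosses_mem u r : crosses u r -> r \in refls u.
Proof. by rewrite /crosses -has_pred1 has_count; case: (count _ _). Qed.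

Lemma uniq_refls_mem u r : uniq (refls u) -> (r \in refls u) = crosses u r.
Proof. by move=> Uu; rewrite /crosses count_uniq_mem // oddb. Qed.

(** This is what makes a word that crosses distinct reflections shortest: the
    reflections crossed once have odd parity, hence are crossed by every
    other word for the same element. *)
Lemma uniq_refls_sub u v :
  uniq (refls u) -> wp u = wp v -> {subset refls u <= refls v}.
Proof.
by move=> Uu uv r; rewrite uniq_refls_mem // (crosses_word_prod r uv) => /crosses_mem.
Qed.

Lemma exchange y r : r \in refls y ->
  exists2 y', size y' < size y & wp y = r * wp y'.
Proof.
elim: y r => //= s y IHy r; rewrite inE => /predU1P[->|/mapP[q yq ->]].
  by exists y; rewrite ?word_prodS.
have [y' ltyy' Ey] := IHy q yq; exists (s :: y') => //.
by rewrite !word_prodS gen_conjE Ey -!mulgA genK.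
Qed.

(** Here y represents an element of minimal length in the coset of x modulo the
    parabolic subgroup generated by A: if y crossed a reflection of that
    subgroup, the exchange property would give a shorter representative. *)
Lemma parabolic_factor (A : {pred T}) x : exists a y,
  [/\ all [in A] a, wp x = wp (a ++ y) &
      forall d, all [in A] d -> wp d \notin refls y].
Proof.
pose P k := `[< exists a y, [/\ all [in A] a, wp x = wp (a ++ y) & size y = k] >].
have exP : exists k, P k.
  by exists (size x); apply/asboolP; exists [::], x.
case: (ex_minnP exP) => k /asboolP[a [y [Aa xay syk]]] k_min.
exists a, y; split=> // d Ad; apply/negP => /exchange[y' lt_y' yE].
suff /k_min : P (size y') by rewrite -syk leqNgt lt_y'.
apply/asboolP; exists (a ++ d), y'; split=> //; first by rewrite all_cat Aa.
by rewrite xay !word_prodS yE mulgA.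
Qed.

Section Braid.
Variables (s t : T).
Hypotheses (neq_st : gen s != gen t) (Mst : M s t = 3).

(** Reflections of the dihedral group of s and t are crossed by x as they are by
    its dihedral part, so x can be taken to be a word in s and t.  The wall of
    s t s lies between those of s and t, so among the three walls it is never
    the only one crossed, nor the only one not crossed. *)
Lemma dihedral_crosses x :
  crosses x (gen t ^ gen s) -> crosses x (gen s) || crosses x (gen t).
Proof.
have Mts : M t s = 3 by rewrite cox_m_sym.
have sts : gen s ^ gen t = gen t ^ gen s.
  by rewrite !gen_conjE (gen_braid Mst).
have neq_ts_s : gen t ^ gen s != gen s.
  by rewrite -(can_eq (gen_conjK s)) gen_conjK gen_conjE gen_involution mul1g eq_sym.
have neq_ts_t : gen t ^ gen s != gen t.
  by rewrite -sts -(can_eq (gen_conjK t)) gen_conjK gen_conjE gen_involution mul1g.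
pose A := pred2 s t.
have [a [y [Aa xay yA]]] := parabolic_factor A x.
have yNA d : all [in A] d -> crosses y (wp d) = false.
  by move=> Ad; apply: contraNF (yA d Ad) => /crosses_mem.
have xaE d : all [in A] d -> crosses x (wp d) = crosses a (wp d).
  move=> Ad; rewrite (crosses_word_prod _ xay) crosses_cat.
  rewrite conjgE -word_prod_rev -!word_prod_cat yNA ?addbF //.
  by rewrite !all_cat all_rev Aa Ad.
have stsE : gen t ^ gen s = wp [:: s; t; s].
  by rewrite gen_conjE !word_prodS mulg1 mulgA.
have tE : gen t = wp [:: t] by rewrite !word_prodS mulg1.
have sE : gen s = wp [:: s] by rewrite !word_prodS mulg1.
have As : s \in A by rewrite !inE eqxx.
have At : t \in A by rewrite !inE eqxx orbT.
rewrite stsE sE tE !xaE ?[all _ _]/= ?As ?At // -stsE -sE -tE {xay xaE}.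
(* Prefixing a letter exchanges the two implications, so they are proved
   together. *)
suff: (crosses a (gen t ^ gen s) ==> crosses a (gen s) || crosses a (gen t)) &&
      (crosses a (gen s) && crosses a (gen t) ==> crosses a (gen t ^ gen s)).
  by case/andP => /implyP.
elim: a Aa => //= c a IHa /andP[/pred2P[]-> /IHa].
  rewrite !crosses_cons gen_conjK [gen s ^ gen s]conjgE mulKg eqxx.
  rewrite (negPf neq_ts_s) [_ t == _]eq_sym (negPf neq_st).
  by do 3!case: (crosses a _).
have tst : (gen t ^ gen s) ^ gen t = gen s by rewrite -sts gen_conjK.
rewrite !crosses_cons tst sts [gen t ^ gen t]conjgE mulKg eqxx.
rewrite (negPf neq_ts_t) (negPf neq_st).
by do 3!case: (crosses a _).
Qed.
End Braid.
End Reflections.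

(** * Reduced words and commutations *)

Lemma commute_word_prod (T : choiceType) (M : coxeter_matrix T) s (u : seq T) :
  {in u, forall t, M s t = 2} -> commute (cox_gen M s) (word_prod M u).
Proof.
elim: u => [_|t u IHu sP]; first by rewrite word_prod_nil; apply: commute1.
rewrite word_prod_cons; apply: commuteM.
  by apply/gen_commute/sP/mem_head.
by apply: IHu => r ur; apply: sP; rewrite inE ur orbT.
Qed.

Lemma reduced_expression_exists (T : choiceType) (M : coxeter_matrix T)
    (w : coxeter_group M) : exists u, reduced_expression w u.
Proof.
pose P k := `[< exists2 u, word_prod M u = w & size u = k >].
have exP : exists k, P k.
  have [u wE] := cox_pi_surj w.
  by exists (size u); apply/asboolP; exists u => //; rewrite word_prodE wE.
case: (ex_minnP exP) => k /asboolP[u uw szu] min_k; exists u; split=> // v vw.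
by rewrite szu; apply: min_k; apply/asboolP; exists v.
Qed.

Lemma cox_cong_prod (T : choiceType) (M : coxeter_matrix T) (G : groupType)
    (f : T -> G) u v :
  (forall s t, (f s * f t) ^+ M s t = 1) -> cox_cong M u v ->
  \prod_(s <- u) f s = \prod_(s <- v) f s.
Proof.
move=> f_rel; elim=> {u v} [s t|u u' v v' _ uu' _ vv'|//|//|u v w _ uv _ vw].
- rewrite big_nil -[RHS](f_rel s t); elim: (M s t) => [|k IHk]; first by rewrite big_nil.
  by rewrite /= !big_cons IHk mulgA expgS.
- by rewrite !big_cat uu' vv'.
- by rewrite uv.
Qed.

Lemma commutation_perm (T : choiceType) (M : coxeter_matrix T) (u v : seq T) :
  clos_refl_trans _ (@commutation_step T M) u v -> perm_eq u v.
Proof.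
elim=> {u v} [_ _ [a [b [s [t [_ -> ->]]]]]|//|u v w _ uv _ vw].
  by rewrite perm_cat2l (perm_catCA [:: s] [:: t]).
exact: perm_trans uv vw.
Qed.

(** * Short-braid-avoiding words in simply laced groups *)

Section ShortBraidAvoiding.
Variables (T : choiceType) (M : coxeter_matrix T).
Implicit Types (s t : T) (u v : seq T).

Local Notation gen := (cox_gen M).
Local Notation wp := (word_prod M).

(** The combinatorial version of [commutation_step], where commutation is read
    off the Coxeter matrix; it controls which letters are exchanged. *)
Definition swap_step u v : Prop :=
  exists a b s t, [/\ M s t = 2, u = a ++ [:: s, t & b] & v = a ++ [:: t, s & b]].

Local Notation refls := (@refls T M).
Local Notation swaps := (clos_refl_trans _ swap_step).

Lemma swaps_cat a u v b : swaps u v -> swaps (a ++ u ++ b) (a ++ v ++ b).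
Proof.
elim=> {u v} [_ _ [c [d [s [t [Mst -> ->]]]]]|u|u v w _ uv _]; last exact: rt_trans.
  by apply: rt_step; exists (a ++ c), (d ++ b), s, t; split; rewrite ?catA -?catA.
exact: rt_refl.
Qed.

Lemma swaps_cons s u v : swaps u v -> swaps (s :: u) (s :: v).
Proof. by move/(swaps_cat [:: s] [::]); rewrite /= !cats0. Qed.

Lemma swaps_word_prod u v : swaps u v -> wp u = wp v.
Proof.
elim=> {u v} [_ _ [a [b [s [t [Mst -> ->]]]]]|//|u v w _ uv _ vw]; last by rewrite uv.
by rewrite !word_prodS; congr mul; rewrite !mulgA (gen_commute Mst).
Qed.

Lemma swaps_commutation u v :
  swaps u v -> clos_refl_trans _ (@commutation_step T M) u v.
Proof.
elim=> {u v} [u v [a [b [s [t [/gen_commute Mst -> ->]]]]]|u|u v w _ uv _];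
  [by apply: rt_step; exists a, b, s, t | exact: rt_refl | exact: rt_trans].
Qed.

Lemma swaps_perm u v : swaps u v -> perm_eq u v.
Proof. by move/swaps_commutation/commutation_perm. Qed.

Definition short_braid_avoiding u : Prop :=
  forall v, swaps u v -> forall a b s t,
    v <> a ++ [:: s, s & b] /\ (M s t = 3 -> v <> a ++ [:: s, t, s & b]).

Lemma short_braid_avoiding_swaps u v :
  swaps u v -> short_braid_avoiding u -> short_braid_avoiding v.
Proof. by move=> uv uP w vw; apply/uP/(rt_trans _ _ _ _ _ uv vw). Qed.

Lemma short_braid_avoiding_cons s u :
  short_braid_avoiding (s :: u) -> short_braid_avoiding u.
Proof.
move=> suP v /(swaps_cons s)/suP {}suP a b c d.
by have [ss sts] := suP (s :: a) b c d; split=> [vE|/sts{}sts vE];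
  [apply: ss | apply: sts]; rewrite vE.
Qed.

Hypothesis simply_laced : forall s t, s != t -> M s t = 2 \/ M s t = 3.
Hypothesis gen_inj : injective gen.

(** Let u = s u' with s different from t.  If s and t commute, t is crossed by
    u' and induction applies.  If they are adjacent, s t s is crossed by u' but
    s is not, so t is; moving t to the front of u' leaves a word that crosses s,
    and bringing that s forward as well exhibits the forbidden factor s t s. *)
Lemma short_braid_avoiding_front u t :
  short_braid_avoiding u -> crosses u (gen t) -> exists v, swaps u (t :: v).
Proof.
have [k] := ubnP (size u); elim: k u t => // k IHk [//|s u] t ltuk suP.
have uP := short_braid_avoiding_cons suP.
have [<- _|neq_st] := eqVneq s t; first by exists u; apply: rt_refl.
have neq_gen : gen s != gen t by rewrite (inj_eq gen_inj).
rewrite crosses_cons eq_sym (negPf neq_gen) /= => u_ts.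
have [Mst|Mst] := simply_laced neq_st.
  have ts : gen t ^ gen s = gen t.
    by rewrite conjgE -(gen_commute Mst) mulKg.
  rewrite ts in u_ts; have [v uv] := IHk u t ltuk uP u_ts; exists (s :: v).
  apply: rt_trans (swaps_cons s uv) _.
  by apply: rt_step; exists [::], v, s, t.
have sts : (gen t ^ gen s) ^ gen t = gen s.
  by rewrite !gen_conjE (gen_braid Mst) -!mulgA genK gen_involution mulg1.
(* Were s crossed by the tail, it could be brought next to the leading s. *)
have := dihedral_crosses neq_gen Mst u_ts; case/orP=> [|u_t].
  case/(IHk u s ltuk uP) => v /(swaps_cons s)/suP/(_ [::] v s s)[/=].
  by [].
have [v uv] := IHk u t ltuk uP u_t.
have tvP := short_braid_avoiding_swaps uv uP.
have : crosses v (gen s).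
  move: u_ts; rewrite (crosses_word_prod _ (swaps_word_prod uv)) crosses_cons sts.
  case: eqP => // ts_t; case/eqP: neq_gen.
  by rewrite -sts ts_t conjgE mulKg.
have ltvk : size v < k.
  by move: (ltuk : size u < k); rewrite (perm_size (swaps_perm uv)); apply: ltnW.
case/(IHk v s ltvk (short_braid_avoiding_cons tvP)) => w vw.
have : swaps (s :: u) [:: s, t, s & w].
  by apply/swaps_cons/(rt_trans _ _ _ _ _ uv)/swaps_cons.
by move/suP/(_ [::] w s t) => [_ /(_ Mst)].
Qed.

(** A repeated reflection would mean that some letter s is crossed by the rest
    of the word, and could be brought next to that letter. *)
Lemma short_braid_avoiding_uniq_refls u :
  short_braid_avoiding u -> uniq (refls u).
Proof.
elim: u => //= s u IHu suP; have uP := short_braid_avoiding_cons suP.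
rewrite (map_inj_uniq (@conjg_inj _ _)) IHu // andbT.
apply/mapP => -[r ur sE].
have rE : r = gen s.
  by apply: (@conjg_inj _ (gen s)); rewrite -sE conjgE mulKg.
move: ur; rewrite rE uniq_refls_mem ?IHu //.
case/(short_braid_avoiding_front uP) => v /(swaps_cons s).
by move/suP/(_ [::] v s s) => [].
Qed.

Lemma short_braid_avoiding_size u v :
  short_braid_avoiding u -> wp u = wp v -> size u <= size v.
Proof.
move=> /short_braid_avoiding_uniq_refls Uu uv; rewrite -(@size_refls T M u) -(@size_refls T M v).
exact: uniq_leq_size Uu (uniq_refls_sub Uu uv).
Qed.

(** The first letter of v is a left descent of the common element, hence crossed
    by u, so it can also be made the first letter of u. *)
Lemma short_braid_avoiding_swaps_eq u v :
  short_braid_avoiding u -> wp u = wp v -> size v <= size u -> swaps u v.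
Proof.
elim: v u => [|t v IHv] u uP uv levu.
  by have := short_braid_avoiding_size uP uv; case: u {uP uv levu} => // _; apply: rt_refl.
have Uu := short_braid_avoiding_uniq_refls uP.
have Utv : uniq (refls (t :: v)).
  by apply: leq_size_uniq Uu (uniq_refls_sub Uu uv) _; rewrite !size_refls.
have : crosses u (gen t).
  by rewrite (crosses_word_prod _ uv) -uniq_refls_mem // mem_head.
case/(short_braid_avoiding_front uP) => u' uu'.
apply: (rt_trans _ _ _ _ _ uu'); apply/swaps_cons/IHv.
- exact: short_braid_avoiding_cons (short_braid_avoiding_swaps uu' uP).
- by apply: (mulgI (gen t)); rewrite -!word_prod_cons -(swaps_word_prod uu').
- by rewrite (perm_size (swaps_perm uu')) in levu.
Qed.

Lemma short_braid_avoiding_fc u :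
  short_braid_avoiding u -> fully_commutative (wp u) /\ reduced_expression (wp u) u.
Proof.
move=> uP; have red_u : reduced_expression (wp u) u.
  by split=> // v /esym; apply: short_braid_avoiding_size.
split=> // a b [ua min_a] [ub min_b]; apply: swaps_commutation.
have uva : swaps u a by apply: short_braid_avoiding_swaps_eq => //; apply: min_a.
apply: short_braid_avoiding_swaps_eq; last exact: min_b.
  exact: short_braid_avoiding_swaps uva uP.
by rewrite ua ub.
Qed.
End ShortBraidAvoiding.

(** * Alternating words in two letters *)

Section AlternatingWords.
Variable T : eqType.
Implicit Types (x y : T) (u w : seq T).

Local Notation alternates := (sorted (fun x y : T => x != y)).

Lemma not_alternates (A : {pred T}) u :
  ~~ alternates [seq x <- u | x \in A] ->
  exists a x b c, [/\ u = a ++ x :: b ++ x :: c, x \in A & ~~ has [in A] b].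
Proof.
elim: u => //= y u IHu; case: ifP => [Ay|_]; last first.
  by case/IHu => a [x [b [c [-> Ax bA]]]]; exists (y :: a), x, b, c.
have [Au|uA] := boolP (has [in A] u); last first.
  rewrite (eq_in_filter (a2 := pred0)) ?filter_pred0 // => x ux.
  by apply: contraNF uA => Ax; apply/hasP; exists x.
case/split_find: Au IHu => x b c Ax bA; rewrite cat_rcons filter_cat /= Ax.
have -> : [seq z <- b | z \in A] = [::] by apply/eqP; rewrite -[_ == _]negbK -has_filter.
have [<- _ _|neq_yx IHu] := eqVneq y x; first by exists [::], y, b, c.
rewrite /= neq_yx => /IHu[a [z [d [e [E Az dA]]]]].
by exists (y :: a), z, d, e; rewrite E.
Qed.

Lemma count_mem_gt1 x u : 1 < count_mem x u ->
  exists a b c, u = a ++ x :: b ++ x :: c /\ x \notin b.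
Proof.
move=> ux; have : ~~ alternates [seq y <- u | y \in pred1 x].
  move: ux; rewrite -size_filter; have := filter_all (pred1 x) u.
  by case: [seq y <- u | _] => [|y [|z v]] //= /and3P[/eqP-> /eqP-> _]; rewrite eqxx.
case/not_alternates => a [y [b [c [-> /eqP-> bx]]]]; exists a, b, c; split=> //.
by rewrite -has_pred1.
Qed.

(** In an alternating sequence the numbers of a and of b differ by at most one,
    and the first and last letters tell by how much. *)
Lemma alternates_cycle (a b : T) w : a != b -> all (pred2 a b) w -> alternates w ->
  cycle (fun x y => x != y) w = (count_mem a w == count_mem b w).
Proof.
case: w => //= x p neq_ab xp_ab xp; rewrite rcons_path xp /=.
have : (x == a) + count_mem a p + (last x p == b) =
       (x == b) + count_mem b p + (x == a).
  elim: p x xp_ab xp => [x _ _|y p IHp x /= /andP[xab yp_ab] /andP[neq_xy yp]].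
    by rewrite /= !addn0 addnC.
  have := IHp y yp_ab yp.
  case/andP: yp_ab => yab _.
  case/pred2P: xab neq_xy => ->; case/pred2P: yab => -> neq_xy;
    rewrite ?eqxx ?[b == a]eq_sym ?(negPf neq_ab) in neq_xy * => //=; lia.
have : (last x p == a) || (last x p == b).
  exact: (allP (xp_ab : all (pred2 a b) (x :: p)) _ (mem_last x p)).
case/andP: xp_ab => xab _.
case/pred2P: xab => -> ; case/orP => /eqP ->;
    rewrite ?eqxx ?[b == a]eq_sym ?(negPf neq_ab) /=; lia.
Qed.

Lemma cycle_alternates w : cycle (fun x y => x != y) w -> alternates w.
Proof. by case: w => //= x p; rewrite rcons_path => /andP[]. Qed.

Lemma count_mem_filter (A : pred T) x u : A x ->
  count_mem x (filter A u) = count_mem x u.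
Proof.
move=> Ax; rewrite count_filter; apply: eq_count => y /=.
by case: eqP => //= ->.
Qed.

Lemma size_filter_pred2 (a b : T) u : a != b ->
  size (filter (pred2 a b) u) = count_mem a u + count_mem b u.
Proof.
move=> neq_ab; rewrite size_filter; elim: u => //= x u ->.
by case: (eqVneq x a) => [->|_]; rewrite ?(negPf neq_ab) /=; lia.
Qed.

End AlternatingWords.

(** * The affine group of type A *)

Section AffineA.
Variable n : nat.
Hypothesis n_gt2 : 2 < n.
Implicit Types (i j s t p q : 'I_n) (u v : seq 'I_n).

Local Notation M := (affineA_matrix n).
Local Notation gen := (cox_gen M).
Local Notation wp := (word_prod M).
Local Notation swaps := (clos_refl_trans _ (swap_step M)).

Lemma val_iter_ordS m i : iter m (@ordS n) i = (i + m) %% n :> nat.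
Proof.
elim: m => [|m IHm]; first by rewrite addn0 modn_small.
by rewrite iterS /= IHm -addn1 modnDml addn1 addnS.
Qed.

Lemma iter_ordS_neq m i : 0 < m < n -> iter m (@ordS n) i != i.
Proof.
case/andP=> m_gt0 ltmn; rewrite -val_eqE /= val_iter_ordS.
rewrite -[X in _ != X](modn_small (ltn_ord i)) -[X in _ != X %% _]addn0 eqn_modDl.
by rewrite mod0n modn_small // -lt0n.
Qed.

Lemma ordS_neq i : ordS i != i.
Proof. exact: (@iter_ordS_neq 1 i (ltnW n_gt2)). Qed.

(** This is where n > 2 matters: the two neighbours of a node are distinct. *)
Lemma ordSS_neq i : ordS (ordS i) != i.
Proof. exact: (@iter_ordS_neq 2 i n_gt2). Qed.

Lemma ordS_ind (P : 'I_n -> Prop) i :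
  P i -> (forall j, P j -> P (ordS j)) -> forall j, P j.
Proof.
move=> Pi PS j; have -> : j = iter (j + (n - i)) (@ordS n) i.
  apply: val_inj; rewrite /= val_iter_ordS addnCA subnKC 1?ltnW //.
  by rewrite modnDr modn_small.
by elim: (_ + _) => //= m; apply: PS.
Qed.

Lemma affineA_m_ordS i : affineA_m i (ordS i) = 3.
Proof. by rewrite /affineA_m eq_sym (negPf (ordS_neq i)) eqxx. Qed.

Lemma affineA_m_eq3 i j : affineA_m i j = 3 -> j = ordS i \/ i = ordS j.
Proof. by rewrite /affineA_m; case: eqP => // _; case: ifP => // /orP[]/eqP; auto. Qed.

Lemma affineA_simply_laced i j : i != j -> M i j = 2 \/ M i j = 3.
Proof. by rewrite /= /affineA_m => /negPf->; case: ifP; auto. Qed.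

Lemma affineA_other_neighbor s p : M s p = 3 ->
  exists2 q : 'I_n, M s q = 3 & forall t, t != s -> t != p -> t != q -> M s t = 2.
Proof.
case/affineA_m_eq3 => sp.
  exists (ord_pred s) => [|t ts tp tq].
    by rewrite cox_m_sym -{2}(ord_predK s); apply: affineA_m_ordS.
  rewrite /= /affineA_m eq_sym (negPf ts) -sp (negPf tp) /=.
  by case: eqP => // st; rewrite st ordSK eqxx in tq.
exists (ordS s) => [|t ts tp tq]; first exact: affineA_m_ordS.
rewrite /= /affineA_m eq_sym (negPf ts) (negPf tq) /=.
by case: eqP => // st; rewrite (ordS_inj (etrans (esym st) sp)) eqxx in tp.
Qed.

(** The affine group acts on the n residues by adjacent transpositions; this
    finite quotient is enough to tell the generators apart. *)
Lemma tperm_adjacent_relation i j :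
  (tperm i (ordS i) * tperm j (ordS j)) ^+ M i j = 1.
Proof.
have braid (k : 'I_n) : (tperm k (ordS k) * tperm (ordS k) (ordS (ordS k))) ^+ 3 = 1.
  have aba : tperm k (ordS k) * tperm (ordS k) (ordS (ordS k)) * tperm k (ordS k) =
    tperm k (ordS (ordS k)).
    rewrite -{1}(tpermV k (ordS k)) -mulgA -conjgE tpermJ tpermR tpermD //.
      by rewrite eq_sym ordSS_neq.
    by rewrite eq_sym ordS_neq.
  have bab : tperm (ordS k) (ordS (ordS k)) * (tperm k (ordS k) * tperm (ordS k) (ordS (ordS k))) =
    tperm k (ordS (ordS k)).
    rewrite -{1}(tpermV (ordS k)) -conjgE tpermJ tpermL tpermD //.
      exact: ordS_neq.
    exact: ordSS_neq.
  by rewrite expgS expg2 -!mulgA bab !mulgA aba tperm2.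
have [<-|neq_ij] := eqVneq i j.
  by rewrite /= /affineA_m eqxx tperm2 expg1.
have [Mij|Mij] := affineA_simply_laced neq_ij; rewrite Mij; last first.
  case/affineA_m_eq3: Mij => [->|->]; first exact: braid.
  apply: invg_inj; rewrite invg1 -expVgn invgM !tpermV; exact: braid.
have {Mij} [neq_jSi neq_iSj] : j != ordS i /\ i != ordS j.
  by move: Mij; rewrite /= /affineA_m (negPf neq_ij); case: ifP => // /norP[].
have /conjg_fixP/commgP tC : tperm i (ordS i) ^ tperm j (ordS j) = tperm i (ordS i).
  by rewrite tpermJ !tpermD ?(inj_eq (@ordS_inj n)) // eq_sym.
by rewrite expgMn // !expg2 !tperm2 mulg1.
Qed.

Lemma affineA_gen_inj : injective gen.
Proof.
move=> i j /cox_piP /(cox_cong_prod tperm_adjacent_relation).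
rewrite !big_seq1 => tE; have := tpermL i (ordS i); rewrite tE.
case: tpermP => [-> //|-> jSSj|_ _ iSi].
  by have := ordSS_neq j; rewrite -jSSj eqxx.
by have := ordS_neq i; rewrite -iSi eqxx.
Qed.

Lemma swap_filter_pair u v i : swaps u v ->
  [seq x <- u | (x == i) || (x == ordS i)] =
  [seq x <- v | (x == i) || (x == ordS i)].
Proof.
elim=> {u v} [_ _ [a [b [s [t [Mst -> ->]]]]]|//|u v w _ -> _ -> //].
have : ~~ (pred2 i (ordS i) s && pred2 i (ordS i) t).
  apply/negP => /andP[/pred2P si /pred2P ti].
  case: si ti Mst => -> [] ->; rewrite /= ?affineA_m_ordS ?(affineA_m_sym (ordS i)) //;
    by rewrite ?affineA_m_ordS // /affineA_m eqxx.
rewrite !filter_cat /= => st; congr (_ ++ _).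
by move: st; do 2!case: ifP.
Qed.

Lemma alternating_swaps u v : swaps u v -> alternating u -> alternating v.
Proof.
by move=> uv ualt i; have := ualt i; rewrite (swap_filter_pair i uv).
Qed.

(** In a factor s t s with t adjacent to s, the letters s and the neighbour of s
    other than t would violate alternation. *)
Lemma alternating_short_braid_avoiding u :
  alternating u -> short_braid_avoiding M u.
Proof.
move=> ualt v uv a b s t; have valt := alternating_swaps uv ualt.
have no_rep i c d : ~~ sorted (fun x y => x != y) (c ++ i :: i :: d).
  by rewrite sorted_cat_cons /= eqxx andbF.
split=> [vE|/affineA_m_eq3 st vE].
  have := valt s; rewrite vE filter_cat /= !eqxx /=.
  by rewrite (negPf (no_rep _ _ _)).
(* The pair i, i+1 consisting of s and its neighbour other than t. *)
have [i [si ti]] : exists i, pred2 i (ordS i) s /\ ~~ pred2 i (ordS i) t.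
  case: st => st.
    exists (ord_pred s); rewrite /= ord_predK eqxx orbT st; split=> //.
    rewrite negb_or ordS_neq // andbT.
    by rewrite -{1}(ord_predK s) ordSS_neq.
  exists s; rewrite /= eqxx; split=> //; rewrite negb_or st.
  by rewrite eq_sym ordS_neq // eq_sym ordSS_neq.
have := valt i; rewrite vE filter_cat /= -[(s == i) || _]/(pred2 i (ordS i) s) si.
rewrite -[(t == i) || _]/(pred2 i (ordS i) t) (negPf ti).
by rewrite (negPf (no_rep _ _ _)).
Qed.

(** Induction on the distance between the two letters s, with q the neighbour of
    s other than p: if p and s do not occur between them, then only the letters
    q there may fail to commute with s. *)
Lemma fc_consecutive u a b c s p :
  fully_commutative (wp u) -> reduced_expression (wp u) u ->
  u = a ++ s :: b ++ s :: c -> M s p = 3 -> s \notin b -> p \in b.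
Proof.
move=> u_fc red_u; have [k] := ubnP (size b).
elim: k a b c s p => // k IHk a b c s p ltbk uE Msp sb; apply/negPn/negP => pb.
have [_ min_u] := red_u.
have [q Msq sP] := affineA_other_neighbor Msp.
have [qb|] := leqP (count_mem q b) 1; last first.
  case/count_mem_gt1 => b0 [b1 [b2 [bE qb1]]].
  (* Two consecutive letters q with no s in between form a closer pair of equal
     letters that misses a neighbour. *)
  have : s \in b1.
    apply: (IHk (a ++ s :: b0) b1 (b2 ++ s :: c) q) => //.
    - by move: ltbk; rewrite bE size_cat /= size_cat /=; lia.
    - by rewrite uE bE -!catA /= -!catA.
    - by rewrite cox_m_sym.
  by move=> sb1; rewrite bE !(mem_cat, inE) sb1 !orbT in sb.
have commuteL x y z : commute x y -> x * (y * z) = y * (x * z) :> affineA n.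
  by rewrite !mulgA => ->.
have sC d : {subset d <= b} -> q \notin d -> commute (gen s) (wp d).
  move=> db qd; apply: commute_word_prod => t td.
  by apply: sP; [apply: contraNneq sb|apply: contraNneq pb|apply: contraNneq qd] => <- //;
    apply: db.
have [qb0|qb1] := boolP (q \in b); last first.
  have : wp (a ++ b ++ c) = wp u.
    rewrite uE !word_prodS; congr mul.
    by rewrite (commuteL _ _ _ (sC b _ qb1)) ?genK.
  by move/min_u; rewrite uE !size_cat /= size_cat /=; lia.
have [b1 [b2 bE]] : exists b1 b2, b = b1 ++ q :: b2.
  by case/splitPr: qb0 => b1 b2; exists b1, b2.
have [qb1 qb2] : q \notin b1 /\ q \notin b2.
  move: qb; rewrite bE count_cat /= eqxx => qb.
  by split; apply/count_memPn => /=; move: qb; lia.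
have {}sC : commute (gen s) (wp b1) /\ commute (gen s) (wp b2).
  by split; apply: sC => // t tb; rewrite bE mem_cat ?inE tb ?orbT.
(* The braid relation replaces s q s by q s q, and commutations cannot bring
   back the multiplicity of s. *)
pose v := a ++ b1 ++ [:: q, s, q & b2 ++ c].
have vu : wp v = wp u.
  rewrite uE bE !word_prodS -!mulgA; congr mul.
  rewrite (commuteL _ _ _ sC.1) -(commuteL _ _ _ sC.2); congr mul.
  by rewrite !mulgA (gen_braid Msq).
have red_v : reduced_expression (wp u) v.
  split=> // x /min_u; suff -> : size v = size u by [].
  by rewrite uE bE; do 3!rewrite ?size_cat /=; lia.
have /commutation_perm/seq.permP/(_ (pred1 s)) := u_fc u v red_u red_v.
have neq_qs : q != s.
  by apply: contra_eq_neq Msq => ->; rewrite /= /affineA_m eqxx.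
rewrite uE bE; do 3!rewrite ?count_cat /=; rewrite eqxx (negPf neq_qs).
lia.
Qed.

Lemma fc_alternating u :
  fully_commutative (wp u) -> reduced_expression (wp u) u -> alternating u.
Proof.
move=> u_fc red_u i; apply/negPn/negP => /(@not_alternates _ (pred2 i (ordS i))).
case=> a [s [b [c [uE si]]]]; apply/negP; rewrite negbK.
have [p Msp pi] : exists2 p : 'I_n, M s p = 3 & pred2 i (ordS i) p.
  case/pred2P: si => ->.
    by exists (ordS i); [exact: affineA_m_ordS | rewrite /= eqxx orbT].
  by exists i; [rewrite cox_m_sym; exact: affineA_m_ordS | rewrite /= eqxx].
have [sb|sb] := boolP (s \in b); first by apply/hasP; exists s.
by apply/hasP; exists p => //; apply: fc_consecutive u_fc red_u uE Msp sb.
Qed.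

Definition cfc_shape u : Prop :=
  (forall i, count_mem i u <= 1) \/
  (alternating u /\ exists2 k, 2 <= k & forall i, count_mem i u = k).

Lemma cfc_shape_alternating u : cfc_shape u -> alternating u.
Proof.
case=> [u1|[]//] i; have uniq_u : uniq u.
  apply: count_mem_uniq => s; have := u1 s.
  by rewrite -has_pred1 has_count; case: (count _ _) => [|[]].
have := filter_uniq (pred2 i (ordS i)) uniq_u; rewrite uniq_pairwise.
exact: pairwise_sorted.
Qed.

Lemma cfc_shape_perm u v :
  perm_eq u v -> alternating v -> cfc_shape u -> cfc_shape v.
Proof.
move=> /seq.permP uv valt [u1|[_ [k k2 uk]]]; first by left=> i; rewrite -uv.
by right; split=> //; exists k => // i; rewrite -uv.
Qed.

Lemma pair_cycle u i : alternating u ->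
  cycle (fun x y => x != y) [seq x <- u | (x == i) || (x == ordS i)] =
  (count_mem i u == count_mem (ordS i) u).
Proof.
move=> ualt; rewrite (@alternates_cycle _ i (ordS i)) ?filter_all //.
  by rewrite !count_mem_filter //= ?eqxx ?orbT.
by rewrite eq_sym ordS_neq.
Qed.

(** Equal multiplicities make each two-letter subword alternate cyclically, and
    rotating the word only rotates these subwords. *)
Lemma cfc_shape_rot u k : cfc_shape u -> cfc_shape (rot k u).
Proof.
move=> uS; have ualt := cfc_shape_alternating uS.
case: (uS) => [u1|[_ [m m2 um]]].
  by left=> i; rewrite (seq.permP (permEl (perm_rot k u))).
apply: cfc_shape_perm uS; first by rewrite perm_sym perm_rot.
move=> i; apply: cycle_alternates.
rewrite filter_cat cycle_catC -filter_cat cat_take_drop pair_cycle //.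
by rewrite !um.
Qed.

(** Rotating the word past the first letter x of the pair moves x from the front
    of the two-letter subword to its end, where it must differ from the last
    letter as soon as there are at least two letters. *)
Lemma rot_alternating_count u i : (forall k, alternating (rot k u)) ->
  count_mem i u = count_mem (ordS i) u \/ count_mem i u + count_mem (ordS i) u <= 1.
Proof.
move=> u_rot; have ualt := u_rot 0; rewrite rot0 in ualt.
have neq_iSi : i != ordS i by rewrite eq_sym ordS_neq.
have [|w2] := leqP (size (filter (pred2 i (ordS i)) u)) 1.
  by rewrite size_filter_pred2 //; right.
left; apply/eqP; rewrite -pair_cycle //.
have : has (pred2 i (ordS i)) u.
  by rewrite has_filter; case: (filter _ _) w2.
move=> ui; case/split_find: ui u_rot ualt w2 => x b c xi bi u_rot ualt w2.
have := u_rot (size b).+1 i; have := ualt i.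
rewrite -(size_rcons b x) rot_size_cat cat_rcons !filter_cat -cats1 filter_cat.
have bE : [seq z <- b | (z == i) || (z == ordS i)] = [::].
  by apply/eqP; rewrite -[_ == _]negbK -has_filter.
have {}xi : (x == i) || (x == ordS i) by [].
move: w2; rewrite cat_rcons filter_cat bE /= xi.
case: (filter _ c) => //= y w _ /andP[neq_xy _].
by rewrite cats1 neq_xy.
Qed.

(** Both alternatives of [rot_alternating_count] propagate a multiplicity at
    most 1 to the next node of the cycle; if no multiplicity is that small, only
    equality remains. *)
Lemma rot_alternating_cfc_shape u : (forall k, alternating (rot k u)) -> cfc_shape u.
Proof.
move=> u_rot; have ualt := u_rot 0; rewrite rot0 in ualt.
have uS i := rot_alternating_count i u_rot.
have [/existsP[i ui]|/existsPn u2] := boolP [exists i, count_mem i u <= 1].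
  left; apply: ordS_ind ui _ => j uj.
  by case: (uS j) => [<- //|]; apply: leq_trans; apply: leq_addl.
have {}uS i : count_mem (ordS i) u = count_mem i u.
  case: (uS i) => // uSi; case/negP: (u2 i).
  by apply: leq_trans uSi; apply: leq_addr.
right; split=> //; exists (count_mem (Ordinal (ltnW (ltnW n_gt2))) u).
  by rewrite ltnNge u2.
by apply: ordS_ind (erefl _) _ => j <-.
Qed.

Lemma cfc_cfc_shape w u : cyclically_fully_commutative w ->
  reduced_expression (w : affineA n) u -> cfc_shape u.
Proof.
move=> w_cfc red_u; apply: rot_alternating_cfc_shape => k.
have [x x_fc red_x] := w_cfc u red_u k.
by have xE := red_x.1; rewrite -xE in x_fc red_x; apply: fc_alternating.
Qed.

Lemma cfc_shape_cfc w u :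
  reduced_expression (w : affineA n) u -> cfc_shape u -> cyclically_fully_commutative w.
Proof.
move=> [uw min_u] uS v [vw min_v] k.
have ualt := cfc_shape_alternating uS.
have uv : swaps u v.
  apply: (short_braid_avoiding_swaps_eq affineA_simply_laced affineA_gen_inj).
  - exact: alternating_short_braid_avoiding.
  - by rewrite uw vw.
  - exact: min_v.
have vS := cfc_shape_perm (swaps_perm uv) (alternating_swaps uv ualt) uS.
have /cfc_shape_alternating/alternating_short_braid_avoiding := cfc_shape_rot k vS.
case/(short_braid_avoiding_fc affineA_simply_laced affineA_gen_inj).
by exists (wp (rot k v)).
Qed.

End AffineA.

(** * The characterization *)

Theorem theorem2p1 (n : nat) (hn : 3 <= n) (w : affineA n) :
  let condition (u : seq 'I_n) : Prop :=
    (forall i : 'I_n, count_mem i u <= 1) \/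
    (alternating u /\
     exists2 k : nat, 2 <= k & forall i : 'I_n, count_mem i u = k) in
  (cyclically_fully_commutative w <->
     exists2 u, reduced_expression w u & condition u) /\
  (cyclically_fully_commutative w <->
     forall u, reduced_expression w u -> condition u).
Proof.
have [u0 red_u0] := reduced_expression_exists w.
split; split=> [w_cfc|].
- by exists u0 => //; apply: cfc_cfc_shape red_u0.
- by case=> u red_u /(cfc_shape_cfc hn red_u).
- by move=> u; apply: cfc_cfc_shape.
- by move/(_ u0 red_u0)/(cfc_shape_cfc hn red_u0).
Qed.
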